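(* Let $(A,\nwarrow,\nearrow,\alpha)$ be a real $3$-Hom-L-dendriform algebra and let $J$ be an almost complex structure on $A$ (a linear map $J:A\to A$ with $J^2=-\mathrm{id}_A$) commuting with $\alpha$. If for all $x,y,z\in A$ $$J\nwarrow(x,y,z)=\nwarrow(Jx,y,z)=\nwarrow(x,y,Jz),$$ $$J\nearrow(x,y,z)=\nearrow(Jx,y,z)=\nearrow(x,Jy,z)=\nearrow(x,y,Jz),$$ then $J$ is a complex structure on $A$ (called a strict complex structure).
   Context: Vector spaces are finite-dimensional over $\mathbb R$ or $\mathbb C$; ''real'' means over $\mathbb R$. A $3$-Hom-L-dendriform algebra is a tuple $(A,\nwarrow,\nearrow,\alpha)$ where $A$ is a vector space, $\nwarrow,\nearrow:\otimes^3A\to A$ and $\alpha:A\to A$ are linear, $\alpha$ is multiplicative (i.e. $\alpha(\nwarrow(x,y,z))=\nwarrow(\alpha(x),\alpha(y),\alpha(z))$ and likewise for $\nearrow$), and, writing $\{x,y,z\}^h=\nwarrow(x,y,z)+\nearrow(x,y,z)-\nearrow(y,x,z)$, $\{x,y,z\}^v=\nwarrow(x,y,z)+\nearrow(z,x,y)-\nearrow(z,y,x)$, $[x,y,z]^C=\{x,y,z\}^h+\{y,z,x\}^h+\{z,x,y\}^h$ (equal to the same cyclic sum of $\{\cdot,\cdot,\cdot\}^v$), the following hold for all $x_1,\dots,x_5\in A$ (where $\circlearrowleft_{1,2,3}$ is the sum over cyclic permutations of the indices $1,2,3$): (0) $\nwarrow(x_1,x_2,x_3)+\nwarrow(x_2,x_1,x_3)=0$;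 (1) $\nwarrow(\alpha(x_1),\alpha(x_2),\nwarrow(x_3,x_4,x_5))-\nwarrow(\alpha(x_3),\alpha(x_4),\nwarrow(x_1,x_2,x_5))=\nwarrow([x_1,x_2,x_3]^C,\alpha(x_4),\alpha(x_5))-\nwarrow([x_1,x_2,x_4]^C,\alpha(x_3),\alpha(x_5))$; (2) $\nwarrow(\alpha(x_1),\alpha(x_2),\nearrow(x_5,x_3,x_4))-\nearrow(\alpha(x_5),\alpha(x_3),\{x_1,x_2,x_4\}^h)=\nearrow(\alpha(x_5),[x_1,x_2,x_3]^C,\alpha(x_4))+\nearrow(\{x_1,x_2,x_5\}^v,\alpha(x_3),\alpha(x_4))$; (3) $\nearrow(\alpha(x_5),\alpha(x_1),\{x_2,x_3,x_4\}^h)-\nwarrow(\alpha(x_2),\alpha(x_3),\nearrow(x_5,x_1,x_4))=\nearrow(\{x_1,x_2,x_5\}^v,\alpha(x_3),\alpha(x_4))-\nearrow(\{x_1,x_3,x_5\}^v,\alpha(x_2),\alpha(x_4))$; (4) $\nwarrow([x_1,x_2,x_3]^C,\alpha(x_4),\alpha(x_5))=\circlearrowleft_{1,2,3}\nwarrow(\alpha(x_1),\alpha(x_2),\nwarrow(x_3,x_4,x_5))$; (5) $\nearrow(\alpha(x_5),[x_1,x_2,x_3]^C,\alpha(x_4))=\circlearrowleft_{1,2,3}\nwarrow(\alpha(x_1),\alpha(x_2),\nearrow(x_5,x_3,x_4))$; (6) $\nwarrow(\alpha(x_1),\alpha(x_2),\nearrow(x_5,x_3,x_4))+\nearrow(\alpha(x_5),\alpha(x_1),\{x_2,x_3,x_4\}^h)=\nearrow(\alpha(x_5),\alpha(x_2),\{x_1,x_3,x_4\}^h)+\nearrow(\{x_1,x_2,x_5\}^v,\alpha(x_3),\alpha(x_4))$.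 A complex structure on $A$ is a linear map $J:A\to A$ with $J^2=-\mathrm{id}_A$ which is a Nijenhuis operator; equivalently $J^2=-\mathrm{id}_A$, $J\alpha=\alpha J$ and, for $\ast\in\{\nwarrow,\nearrow\}$ and all $x,y,z\in A$, $$J\ast(x,y,z)=-\ast(Jx,Jy,Jz)+\ast(Jx,y,z)+\ast(x,Jy,z)+\ast(x,y,Jz)+J\ast(Jx,Jy,z)+J\ast(x,Jy,Jz)+J\ast(Jx,y,Jz).$$ *)

(* Defs.v *)
From HB Require Import structures.
From mathcomp Require Import all_boot all_order all_algebra.
From mathcomp Require Import reals.

Set Implicit Arguments.
Unset Strict Implicit.
Unset Printing Implicit Defensive.

Import GRing.Theory.
Local Open Scope ring_scope.

(* A linear map from the third tensor power of A to A is encoded as a curried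
   map that is linear in each of its three arguments. *)
Definition trilinear (K : fieldType) (A : vectType K)
    (f : A -> A -> A -> A) : Prop :=
  [/\ forall y z, linear (fun x => f x y z),
      forall x z, linear (fun y => f x y z)
    & forall x y, linear (fun z => f x y z)].

Definition multiplicative3 (K : fieldType) (A : vectType K)
    (f : A -> A -> A -> A) (alpha : 'End(A)) : Prop :=
  forall x y z, alpha (f x y z) = f (alpha x) (alpha y) (alpha z).

Definition hbr (K : fieldType) (A : vectType K)
    (nw ne : A -> A -> A -> A) (x y z : A) : A :=
  nw x y z + ne x y z - ne y x z.

Definition vbr (K : fieldType) (A : vectType K)
    (nw ne : A -> A -> A -> A) (x y z : A) : A :=
  nw x y z + ne z x y - ne z y x.

Definition cbr (K : fieldType) (A : vectType K)
    (nw ne : A -> A -> A -> A) (x y z : A) : A :=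
  hbr nw ne x y z + hbr nw ne y z x + hbr nw ne z x y.

Lemma cbr_vbr (K : fieldType) (A : vectType K)
    (nw ne : A -> A -> A -> A) (x y z : A) :
  cbr nw ne x y z = vbr nw ne x y z + vbr nw ne y z x + vbr nw ne z x y.
Proof.
rewrite /cbr /hbr /vbr; move: (nw _ _ _) (nw _ _ _) (nw _ _ _) => a b c.
by rewrite (AC (3*3*3) ((1*8*6)*(4*2*9)*(7*5*3)))%AC.
Qed.

(* [nw], [ne] are the products written with a north-west, north-east arrow;
   [hbr], [vbr], [cbr] are {x,y,z}^h, {x,y,z}^v and [x,y,z]^C. *)
Record is_3HomLDendriform (K : fieldType) (A : vectType K)
    (nw ne : A -> A -> A -> A) (alpha : 'End(A)) : Prop := Is3HomLDendriform {
  nw_trilinear : trilinear nw;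
  ne_trilinear : trilinear ne;
  nw_multiplicative : multiplicative3 nw alpha;
  ne_multiplicative : multiplicative3 ne alpha;
  dend0 : forall x1 x2 x3, nw x1 x2 x3 + nw x2 x1 x3 = 0;
  dend1 : forall x1 x2 x3 x4 x5,
    nw (alpha x1) (alpha x2) (nw x3 x4 x5)
      - nw (alpha x3) (alpha x4) (nw x1 x2 x5)
    = nw (cbr nw ne x1 x2 x3) (alpha x4) (alpha x5)
      - nw (cbr nw ne x1 x2 x4) (alpha x3) (alpha x5);
  dend2 : forall x1 x2 x3 x4 x5,
    nw (alpha x1) (alpha x2) (ne x5 x3 x4)
      - ne (alpha x5) (alpha x3) (hbr nw ne x1 x2 x4)
    = ne (alpha x5) (cbr nw ne x1 x2 x3) (alpha x4)
      + ne (vbr nw ne x1 x2 x5) (alpha x3) (alpha x4);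
  dend3 : forall x1 x2 x3 x4 x5,
    ne (alpha x5) (alpha x1) (hbr nw ne x2 x3 x4)
      - nw (alpha x2) (alpha x3) (ne x5 x1 x4)
    = ne (vbr nw ne x1 x2 x5) (alpha x3) (alpha x4)
      - ne (vbr nw ne x1 x3 x5) (alpha x2) (alpha x4);
  dend4 : forall x1 x2 x3 x4 x5,
    nw (cbr nw ne x1 x2 x3) (alpha x4) (alpha x5)
    = nw (alpha x1) (alpha x2) (nw x3 x4 x5)
      + nw (alpha x2) (alpha x3) (nw x1 x4 x5)
      + nw (alpha x3) (alpha x1) (nw x2 x4 x5);
  dend5 : forall x1 x2 x3 x4 x5,
    ne (alpha x5) (cbr nw ne x1 x2 x3) (alpha x4)
    = nw (alpha x1) (alpha x2) (ne x5 x3 x4)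
      + nw (alpha x2) (alpha x3) (ne x5 x1 x4)
      + nw (alpha x3) (alpha x1) (ne x5 x2 x4);
  dend6 : forall x1 x2 x3 x4 x5,
    nw (alpha x1) (alpha x2) (ne x5 x3 x4)
      + ne (alpha x5) (alpha x1) (hbr nw ne x2 x3 x4)
    = ne (alpha x5) (alpha x2) (hbr nw ne x1 x3 x4)
      + ne (vbr nw ne x1 x2 x5) (alpha x3) (alpha x4)
}.

(* Ternary analogue of the binary Nijenhuis identity
     f (N x) (N y) = N (f (N x) y + f x (N y)) - N (N (f x y)).
   When N^2 = -1 it reduces to [complex_identity] below. *)
Definition nijenhuis3 (K : fieldType) (A : vectType K)
    (f : A -> A -> A -> A) (N : 'End(A)) : Prop :=
  forall x y z,
    f (N x) (N y) (N z)
    = N (f (N x) (N y) z + f x (N y) (N z) + f (N x) y (N z))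
      - N (N (f (N x) y z + f x (N y) z + f x y (N z)))
      + N (N (N (f x y z))).

Definition is_nijenhuis (K : fieldType) (A : vectType K)
    (nw ne : A -> A -> A -> A) (alpha N : 'End(A)) : Prop :=
  [/\ (N \o alpha)%VF = (alpha \o N)%VF, nijenhuis3 nw N & nijenhuis3 ne N].

Definition almost_complex (K : fieldType) (A : vectType K)
    (J : 'End(A)) : Prop :=
  (J \o J)%VF = - \1%VF.

Definition is_complex_structure (K : fieldType) (A : vectType K)
    (nw ne : A -> A -> A -> A) (alpha J : 'End(A)) : Prop :=
  almost_complex J /\ is_nijenhuis nw ne alpha J.

Definition complex_identity (K : fieldType) (A : vectType K)
    (f : A -> A -> A -> A) (J : 'End(A)) : Prop :=
  forall x y z,
    J (f x y z)
    = - f (J x) (J y) (J z) + f (J x) y z + f x (J y) z + f x y (J z)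
      + J (f (J x) (J y) z) + J (f x (J y) (J z)) + J (f (J x) y (J z)).

Lemma almost_complexE (K : fieldType) (A : vectType K) (J : 'End(A)) :
  almost_complex J -> forall x, J (J x) = - x.
Proof. by move=> JJ x; rewrite -comp_lfunE JJ opp_lfunE id_lfunE. Qed.

Lemma nijenhuis3_complexP (K : fieldType) (A : vectType K)
    (f : A -> A -> A -> A) (J : 'End(A)) :
  almost_complex J -> (nijenhuis3 f J <-> complex_identity f J).
Proof.
move=> /almost_complexE JJ.
have step (a j p q : A) : a = p + q - j <-> j = - a + q + p.
  rewrite -(addrA (- a)) [q + p]addrC; set r := p + q.
  by split=> ->; [rewrite opprB subrK | rewrite opprD opprK addrCA subrr addr0].
split=> H x y z; move/(_ x y z): H; rewrite !JJ opprK.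
  by move/step; rewrite !linearD /= !addrA.
by move=> H; apply/step; rewrite !linearD /= !addrA.
Qed.

Lemma is_complex_structureP (K : fieldType) (A : vectType K)
    (nw ne : A -> A -> A -> A) (alpha J : 'End(A)) :
  is_complex_structure nw ne alpha J <->
  [/\ almost_complex J, (J \o alpha)%VF = (alpha \o J)%VF,
      complex_identity nw J & complex_identity ne J].
Proof.
by split=> [[JJ [Ja /(nijenhuis3_complexP _ JJ) H1 /(nijenhuis3_complexP _ JJ) H2]]
           |[JJ Ja /(nijenhuis3_complexP _ JJ) H1 /(nijenhuis3_complexP _ JJ) H2]].
Qed.

(* Main.v *)
Require Import Defs.
From mathcomp Require Import all_boot all_order all_algebra.
From mathcomp Require Import reals.
Import GRing.Theory.
Local Open Scope ring_scope.

(** Once [J] can be pulled out of every argument of both products, [nijenhuis3_commuting] gives the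
    Nijenhuis identity for each. The hypotheses cover every slot but the middle one of [nw], which
    follows from skew-symmetry. *)

(* If N can be pulled out of each argument of f, every term of the Nijenhuis
   identity is a multiple of N^3 f(x,y,z), with total coefficient 3 - 3 + 1 = 1
   on the right. *)
Lemma nijenhuis3_commuting (K : fieldType) (A : vectType K)
    (f : A -> A -> A -> A) (N : 'End(A)) :
  (forall x y z, f (N x) y z = N (f x y z)) ->
  (forall x y z, f x (N y) z = N (f x y z)) ->
  (forall x y z, f x y (N z) = N (f x y z)) ->
  nijenhuis3 f N.
Proof. by move=> f1 f2 f3 x y z; rewrite !(f1, f2, f3) -!(linearD N) subrr add0r. Qed.

Theorem lemma4p13 (R : realType) (A : vectType R)
    (nw ne : A -> A -> A -> A) (alpha J : 'End(A))
    (A_dend : is_3HomLDendriform nw ne alpha)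
    (J_ac : almost_complex J)
    (J_alpha : (J \o alpha)%VF = (alpha \o J)%VF)
    (J_nw : forall x y z,
      J (nw x y z) = nw (J x) y z /\ nw (J x) y z = nw x y (J z))
    (J_ne : forall x y z,
      [/\ J (ne x y z) = ne (J x) y z,
          ne (J x) y z = ne x (J y) z
        & ne x (J y) z = ne x y (J z)]) :
  is_complex_structure nw ne alpha J.
Proof.
have nw1 x y z : nw (J x) y z = J (nw x y z) by case: (J_nw x y z).
have nw3 x y z : nw x y (J z) = J (nw x y z) by case: (J_nw x y z) => -> ->.
have nwC x y z : nw x y z = - nw y x z.
  by apply/eqP; rewrite -addr_eq0 (dend0 A_dend).
(* [dend0] swaps the first two arguments, so the middle slot reduces to the first; the two signs
   cancel by linearity of [J]. *)
have nw2 x y z : nw x (J y) z = J (nw x y z).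
  by rewrite nwC nw1 -linearN /= -nwC.
have ne1 x y z : ne (J x) y z = J (ne x y z) by case: (J_ne x y z).
have ne2 x y z : ne x (J y) z = J (ne x y z) by case: (J_ne x y z) => -> ->.
have ne3 x y z : ne x y (J z) = J (ne x y z).
  by case: (J_ne x y z) => -> -> ->.
by split=> //; split=> //; apply: nijenhuis3_commuting.
Qed.
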